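(* Let $T,N\ge 1$ be integers, let $y_{1:T}=(y_1,\dots,y_T)$ be the measurements of a state space model with initial distribution $\mu_0$, transition distributions $f_t(\cdot\mid x_{t-1})$ and measurement distributions $g_t(\cdot\mid x_t)$, and let $c_1,\dots,c_T>0$ be fixed (non-random) thresholds. Run the particle filter with rejection control (PF-RC) with $N$ particles and thresholds $c_1,\dots,c_T$, and let $w_t^{(n)}$ ($1\le n\le N$) be the resulting particle weights at time $t$ and $P_t$ the total number of propagation steps performed at time $t$ (including those for the additional particle). Then the marginal likelihood estimator $$\widehat Z=\prod_{t=1}^T\frac{\sum_{n=1}^N w_t^{(n)}}{P_t-1}$$ is unbiased in the sense that $$\mathbb{E}[\widehat Z]=p(y_{1:T}).$$
   Context: State space model: $x_0\sim\mu_0(\cdot)$, $x_t\sim f_t(\cdot\mid x_{t-1})$, $y_t\sim g_t(\cdot\mid x_t)$ for $t=1,\dots,T$, where $x_t$ is the (unobserved) state at time $t$, $y_t$ is the measurement at time $t$, and $g_t(y_t\mid x_t)$ denotes the density (or mass function) of the measurement given the state. The measurements $y_{1:T}$ are given, and the expectation is over the randomness of the algorithm. The marginal likelihood is $$p(y_{1:T})=\int \mu_0(dx_0)\prod_{t=1}^T f_t(dx_t\mid x_{t-1})\,g_t(y_t\mid x_t).$$ Particle filter with rejection control (PF-RC) with $N$ particles and thresholds $c_t>0$. Initialization: for $n=1,\dots,N$ draw $x_0^{(n)}$ independently from $\mu_0$ and set $w_0^{(n)}=1$. Let $\mathcal S_t=\{(x_t^{(n)},w_t^{(n)})\}_{n=1}^N$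 be the weighted particle set at time $t$. For $t=1,\dots,T$, given $\mathcal S_{t-1}$, define one ''trial'' as follows, using fresh independent randomness each time: (i) resample: draw an index $a\in\{1,\dots,N\}$ with $\Pr(a=n)=w_{t-1}^{(n)}/\sum_{m=1}^N w_{t-1}^{(m)}$; (ii) propagate: draw $x'\sim f_t(\cdot\mid x_{t-1}^{(a)})$; (iii) weight: set $w'=g_t(y_t\mid x')$; (iv) accept the trial with probability $\min(1,w'/c_t)$, otherwise reject it. For each $n=1,\dots,N$, repeat trials until one is accepted, and set $x_t^{(n)}=x'$ and $w_t^{(n)}=\max(w',c_t)$ for the accepted trial. Then, for one additional particle, again repeat trials until one is accepted; this particle is not added to $\mathcal S_t$ and its weight is not used. $P_t$ is the total number of propagation steps (one per trial, counting both rejected and accepted trials) performed at time $t$ for the $N$ particles together with the additional particle. *)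

(* Defs.v *)
From mathcomp Require Import all_boot all_order all_algebra.
From mathcomp Require Import all_classical all_reals all_analysis.

Set Implicit Arguments.
Unset Strict Implicit.
Unset Printing Implicit Defensive.

Import Order.TTheory GRing.Theory Num.Theory.

Local Open Scope classical_set_scope.
Local Open Scope ring_scope.

(* State space models. The families are indexed by the time t = 1, 2, ...;
   their values at t = 0 are never used. The density of the measurement
   distribution is taken with respect to a reference measure, so that mass
   functions are the case of a counting measure. *)
Record state_space_model (dX dY : measure_display) (X : measurableType dX)
    (Y : measurableType dY) (R : realType) := StateSpaceModel {
  init : probability X R ;
  trans : nat -> R.-pker X ~> X ;
  meas : nat -> R.-pker X ~> Y ;
  meas_ref : nat -> {measure set Y -> \bar R} ;
  meas_density : nat -> X -> Y -> R ;
  meas_density_ge0 : forall t x z, 0 <= meas_density t x z ;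
  measurable_meas_density : forall t,
    measurable_fun [set: X * Y] (fun p => meas_density t p.1 p.2) ;
  meas_densityE : forall t x (A : set Y), measurable A ->
    meas t x A = (\int[meas_ref t]_(z in A) (meas_density t x z)%:E)%E
}.

Section marginal_likelihood.
Context (dX dY : measure_display) (X : measurableType dX)
  (Y : measurableType dY) (R : realType).
Variables (M : state_space_model X Y R) (y : nat -> Y).
Local Open Scope ereal_scope.

(* The iterated integral of prod_(t < s <= t + k) f_s(dx_s | x_(s-1))
   g_s(y_s | x_s), as a function of x = x_t. *)
Fixpoint likelihood_from (k t : nat) (x : X) : \bar R :=
  if k is k'.+1 then
    \int[trans M t.+1 x]_x'
      ((meas_density M t.+1 x' (y t.+1))%:E * likelihood_from k' t.+1 x')
  else 1.

(* p(y_1, ..., y_T), possibly +oo since y is arbitrary. *)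
Definition marginal_likelihood (T : nat) : \bar R :=
  \int[init M]_x likelihood_from T 0 x.

End marginal_likelihood.

(* Least index at which b holds; 0 (a value that is never used) if none. *)
Definition first_true (b : nat -> bool) : nat :=
  if pselect (exists j, b j) is left h then ex_minn h else 0%N.

(* The random variables of a run with N particles: the initial particles, and
   the outcomes (a, x', accepted) of the trials, where a : nat is the resampled
   index (its law is carried by {0, ..., N - 1}). [trial t n j] is the j-th
   trial (from 0) for slot n at time t; the slots n < N are the particles and
   slot N is the additional particle. The sequence of trials of a slot is
   continued after its first acceptance, but the algorithm only uses it up to
   that point. *)
Record pf_run (dX dO : measure_display) (X : measurableType dX)
    (Omega : measurableType dO) (R : realType) (P : probability Omega R)
    (N : nat) := PFRun {
  x0 : 'I_N -> {RV P >-> X} ;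
  trial : nat -> 'I_N.+1 -> nat -> {RV P >-> (nat * X * bool)%type}
}.

Section particle_filter_rejection_control.
Context (dX dY dO : measure_display) (X : measurableType dX)
  (Y : measurableType dY) (Omega : measurableType dO) (R : realType)
  (P : probability Omega R) (N : nat).
Variables (M : state_space_model X Y R) (y : nat -> Y) (c : nat -> R).
Variable W : pf_run X P N.

Definition proposal t n j (o : Omega) : X := (trial W t n j o).1.2.

Definition accepted t n j (o : Omega) : bool := (trial W t n j o).2.

Definition terminates t n (o : Omega) : Prop := exists j, accepted t n j o.

Definition first_accepted t n (o : Omega) : nat :=
  first_true (fun j => accepted t n j o).

(* All repetitions of trials at the times 1, ..., t come to an end. *)
Definition alive (t : nat) (o : Omega) : Prop :=
  forall s, (1 <= s <= t)%N -> forall n : 'I_N.+1, terminates s n o.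

Definition particle (t : nat) (n : 'I_N) (o : Omega) : X :=
  if t is 0%N then x0 W n o
  else let n' := widen_ord (leqnSn N) n in
       proposal t n' (first_accepted t n' o) o.

Definition weight (t : nat) (n : 'I_N) (o : Omega) : R :=
  if t is 0%N then 1
  else Num.max (meas_density M t (particle t n o) (y t)) (c t).

(* P_t, on the event [alive t] *)
Definition propagations (t : nat) (o : Omega) : nat :=
  (\sum_(n < N.+1) (first_accepted t n o).+1)%N.

(* The law of (a, x', accepted) for one trial at time t, given the particles x
   and the weights w at time t - 1. *)
Definition trial_law (t : nat) (x : 'I_N -> X) (w : 'I_N -> R)
    (B : set (nat * X * bool)) : \bar R :=
  (\sum_(a < N) (w a / \sum_(m < N) w m)%:E *
    \int[trans M t (x a)]_x'
      bernoulli_prob (Num.min 1 (meas_density M t x' (y t) / c t))%R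
        [set b | B (val a, x', b)])%E.

(* The sigma-algebra of the run up to time t. *)
Definition history (t : nat) : set (set Omega) :=
  <<s [set A | (exists n B, measurable B /\ A = x0 W n @^-1` B) \/
        (exists s n j B, [/\ (1 <= s <= t)%N, measurable B &
                             A = trial W s n j @^-1` B])] >>.

(* The initial particles are iid with law [init M]. At each time t + 1 <= T,
   conditionally on the history up to time t, and provided that the algorithm
   gets past time t, the trials are iid with law [trial_law] evaluated at the
   weighted particle set at time t. *)
Definition is_pfrc (T : nat) : Prop :=
  (forall B : 'I_N -> set X, (forall n, measurable (B n)) ->
     P [set o | forall n, B n (x0 W n o)] = (\prod_(n < N) init M (B n))%E)
  /\
  (forall t, (t < T)%N ->
     forall H, history t H -> H `<=` [set o | alive t o] ->
     forall (J : nat) (B : 'I_N.+1 -> nat -> set (nat * X * bool)),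
       (forall n j, measurable (B n j)) ->
     P (H `&` [set o | forall n j, (j < J)%N -> B n j (trial W t.+1 n j o)]) =
     (\int[P]_(o in H) \prod_(n < N.+1) \prod_(j < J)
        trial_law t.+1 (particle t ^~ o) (weight t ^~ o) (B n j))%E).

(* If some repetition of trials does not end, then the number of propagations
   is infinite and the estimate is 0. *)
Definition Zhat (T : nat) (o : Omega) : R :=
  if `[< alive T o >] then
    \prod_(1 <= t < T.+1)
      ((\sum_(n < N) weight t n o) / ((propagations t o)%:R - 1))
  else 0.

End particle_filter_rejection_control.

(* Main.v *)
Require Import Defs.
From mathcomp Require Import all_boot all_order all_algebra finmap ring.
From mathcomp Require Import all_classical all_reals all_analysis.
From mathcomp Require Import measurable_realfun.

Import Order.TTheory GRing.Theory Num.Theory.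
Import numFieldNormedType.Exports.

Local Open Scope classical_set_scope.
Local Open Scope ring_scope.

(* Write Z_t for the product of the first t factors of the estimator and
   L_(t, k) for the likelihood of the k measurements after time t. On the event
   that the run gets past time t, the expectation of
   Z_t * sum_n (w_t^n / sum_m w_t^m) L_(t, T - t)(x_t^n) does not depend on t: it
   is p(y_1, ..., y_T) at t = 0 and E[Zhat] at t = T.
   For the step from t to t + 1, let a be the acceptance probability of a trial
   given the past. The N + 1 numbers of rejections are k with probability
   (1 - a)^(sum k) a^(N + 1), independently of the accepted proposals, and
   min(1, g/c) * max(g, c) = g, so an accepted proposal contributes
   1/a * sum_n (w_t^n / sum_m w_t^m) L_(t, T - t)(x_t^n) to the expectation.
   It remains to see that the mean of N / (P_(t+1) - 1) is a: since
   N / (m + N) * C(m + N, N) = C(m + N - 1, N - 1), summing over the tuples k of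
   sum m turns the factor into a times the negative binomial law with N
   successes. *)

(** * Monotone functionals *)

Definition nnmeasurable {d} {T : measurableType d} {R : realType}
    (f : T -> \bar R) : Prop :=
  measurable_fun [set: T] f /\ forall x, (0 <= f x)%E.

(* Abstracts integration against a measure: mixtures of integrals can be compared
   on indicators without exhibiting them as integrals against one measure. *)
Record nnfunctional {d} {T : measurableType d} {R : realType}
    (I : (T -> \bar R) -> \bar R) : Prop := NNFunctional {
  nnf_ge0 : forall f, (forall x, 0 <= f x)%E -> (0 <= I f)%E ;
  nnf_le : forall f g, nnmeasurable f -> nnmeasurable g ->
    (forall x, f x <= g x)%E -> (I f <= I g)%E ;
  nnf_add : forall f g, nnmeasurable f -> nnmeasurable g ->
    I (fun x => f x + g x)%E = (I f + I g)%E ;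
  nnf_scale : forall (r : R) f, 0 <= r -> nnmeasurable f ->
    I (fun x => r%:E * f x)%E = (r%:E * I f)%E ;
  nnf_cvg : forall (f_ : nat -> T -> \bar R) f,
    (forall n, nnmeasurable (f_ n)) -> nnmeasurable f ->
    (forall x m n, (m <= n)%N -> (f_ m x <= f_ n x)%E) ->
    (forall x, f_ n x @[n --> \oo] --> f x) ->
    I (f_ n) @[n --> \oo] --> I f }.

Section nnfunctional_theory.
Context {d} {T : measurableType d} {R : realType}.
Implicit Types (I J : (T -> \bar R) -> \bar R) (f g : T -> \bar R).
Local Open Scope ereal_scope.

Lemma nnmeasurable_indic (A : set T) :
  measurable A -> nnmeasurable (fun x => (\1_A x)%:E : \bar R).
Proof.
by move=> mA; split=> [|x]; [exact/measurable_EFinP/measurable_indic|rewrite lee_fin].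
Qed.

Lemma nnmeasurableZ (r : R) f : (0 <= r)%R -> nnmeasurable f ->
  nnmeasurable (fun x => r%:E * f x).
Proof.
move=> r0 [mf f0]; split=> [|x]; last by rewrite mule_ge0.
exact: measurable_funeM.
Qed.

Lemma nnmeasurableD f g : nnmeasurable f -> nnmeasurable g ->
  nnmeasurable (fun x => f x + g x).
Proof.
move=> [mf f0] [mg g0]; split=> [|x]; last by rewrite adde_ge0.
exact: emeasurable_funD.
Qed.

Lemma nnmeasurableM f g : nnmeasurable f -> nnmeasurable g ->
  nnmeasurable (fun x => f x * g x).
Proof.
move=> [mf f0] [mg g0]; split=> [|x]; last by rewrite mule_ge0.
exact: emeasurable_funM.
Qed.

Lemma nnmeasurable0 : nnmeasurable (fun _ : T => 0 : \bar R).
Proof. by split. Qed.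

Lemma nnmeasurable1 : nnmeasurable (cst 1 : T -> \bar R).
Proof. by split=> // x; rewrite lee_fin ler01. Qed.

Lemma nnf0 I : nnfunctional I -> I (fun=> 0) = 0.
Proof.
move=> hI; have := @nnf_scale _ _ _ _ hI 0%R (fun=> 0) (lexx _) nnmeasurable0.
by under [X in I X]eq_fun do rewrite mul0e; rewrite mul0e.
Qed.

Lemma nnmeasurable_sum (S : eqType) (s : seq S) (F : S -> T -> \bar R) :
  (forall i, i \in s -> nnmeasurable (F i)) ->
  nnmeasurable (fun x => \sum_(i <- s) F i x).
Proof.
elim: s => [|a s ih] h.
  by under eq_fun do rewrite big_nil; exact: nnmeasurable0.
under eq_fun do rewrite big_cons.
apply: nnmeasurableD; first by apply: h; rewrite mem_head.
by apply: ih => i si; apply: h; rewrite in_cons si orbT.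
Qed.

Lemma nnf_sum I (S : eqType) (s : seq S) (F : S -> T -> \bar R) :
  nnfunctional I -> (forall i, i \in s -> nnmeasurable (F i)) ->
  I (fun x => \sum_(i <- s) F i x) = \sum_(i <- s) I (F i).
Proof.
move=> hI; elim: s => [|a s ih] h.
  by rewrite big_nil; under [X in I X]eq_fun do rewrite big_nil; exact: nnf0.
under [X in I X]eq_fun do rewrite big_cons.
have hs i : i \in s -> nnmeasurable (F i).
  by move=> si; apply: h; rewrite in_cons si orbT.
rewrite big_cons (nnf_add _ hI) ?ih//; first by apply: h; rewrite mem_head.
exact: nnmeasurable_sum.
Qed.

Import HBNNSimple.

(** A simple function is a finite sum of nonnegative multiples of indicators of its level sets, so
    additivity and homogeneity reduce the claim to indicators. *)
Lemma nnf_nnsfun I J (f : {nnsfun T >-> R}) : nnfunctional I -> nnfunctional J ->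
  (forall A, measurable A ->
     I (fun x => (\1_A x)%:E) = J (fun x => (\1_A x)%:E)) ->
  I (EFin \o f) = J (EFin \o f).
Proof.
move=> hI hJ hIJ.
have -> : EFin \o f = fun x => \sum_(y <- fset_set (range f))
    (y%:E * (\1_(f @^-1` [set y]) x)%:E).
  apply/funext => x /=; rewrite [in LHS]fimfunE fsbig_finite//= -sumEFin.
  by apply: eq_bigr => y _; rewrite EFinM.
have mfy y : measurable (f @^-1` [set y]) by [].
have y0 y : y \in fset_set (range f) -> (0 <= y)%R.
  by rewrite in_fset_set// inE => -[x _ <-].
have hy y : y \in fset_set (range f) ->
    nnmeasurable (fun x => y%:E * (\1_(f @^-1` [set y]) x)%:E).
  by move=> ys; apply: nnmeasurableZ; [exact: y0|exact: nnmeasurable_indic].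
rewrite !nnf_sum//; apply: eq_big_seq => y ys.
rewrite (nnf_scale _ hI) ?(nnf_scale _ hJ) ?hIJ//; try exact: y0;
  exact: nnmeasurable_indic.
Qed.

(** The standard extension from indicators to simple functions and then to increasing limits. It
    serves below to pass from laws of events to expectations, once in the past and once in the new
    proposal. *)
Lemma eq_nnfunctional I J : nnfunctional I -> nnfunctional J ->
  (forall A, measurable A ->
     I (fun x => (\1_A x)%:E) = J (fun x => (\1_A x)%:E)) ->
  forall f, nnmeasurable f -> I f = J f.
Proof.
move=> hI hJ hIJ f [mf f0].
pose g := nnsfun_approx measurableT mf.
have gn n : nnmeasurable (EFin \o g n).
  by split=> [|x]; [exact/measurable_EFinP|rewrite lee_fin].
have gnd x m n : (m <= n)%N -> (EFin \o g m) x <= (EFin \o g n) x.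
  by move=> mn; rewrite lee_fin; exact/lefP/nd_nnsfun_approx.
have gf x : (EFin \o g n) x @[n --> \oo] --> f x by exact: cvg_nnsfun_approx.
have hg n : I (EFin \o g n) = J (EFin \o g n) by exact: nnf_nnsfun.
have cI := @nnf_cvg _ _ _ _ hI _ f gn (conj mf f0) gnd gf.
have cJ := @nnf_cvg _ _ _ _ hJ _ f gn (conj mf f0) gnd gf.
apply: (cvg_unique (@ereal_hausdorff R) cI).
by rewrite (_ : (fun n => I _) = fun n => J (EFin \o g n)) //; exact/funext.
Qed.

(** * Constructions of monotone functionals *)

Lemma nnf_eval (x : T) : nnfunctional (fun f => f x : \bar R).
Proof. by split=> // f f0; exact: f0. Qed.

Lemma nnf_mulc (r : R) I : (0 <= r)%R -> nnfunctional I ->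
  nnfunctional (fun f => r%:E * I f).
Proof.
move=> r0 hI; split=> [f f0|f g hf hg fg|f g hf hg|s f s0 hf|f_ f hf hf' nd cf].
- by rewrite mule_ge0// (nnf_ge0 _ hI).
- by rewrite lee_wpmul2l// (nnf_le _ hI).
- by rewrite (nnf_add _ hI)// ge0_muleDr//;
    [case: hf => _; exact: (nnf_ge0 _ hI)|case: hg => _; exact: (nnf_ge0 _ hI)].
- by rewrite (nnf_scale _ hI)// muleCA.
- by apply: cvgeZl => //; exact: (nnf_cvg _ hI).
Qed.

Lemma nnf_bigsum (S : Type) (s : seq S) (K : S -> (T -> \bar R) -> \bar R) :
  (forall i, nnfunctional (K i)) -> nnfunctional (fun f => \sum_(i <- s) K i f).
Proof.
move=> hK; split=> [f f0|f g hf hg fg|f g hf hg|r f r0 hf|f_ f hf hf' nd cf].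
- by rewrite sume_ge0// => i _; exact: (nnf_ge0 _ (hK i)).
- by apply: lee_sum => i _; exact: (nnf_le _ (hK i)).
- by rewrite -big_split; apply: eq_bigr => i _; exact: (nnf_add _ (hK i)).
- rewrite ge0_sume_distrr//; last first.
    by move=> i _; case: hf => _; exact: (nnf_ge0 _ (hK i)).
  by apply: eq_bigr => i _; exact: (nnf_scale _ (hK i)).
- elim: s => [|a s ih].
    by under eq_fun do rewrite big_nil; rewrite big_nil; exact: cvg_cst.
  under eq_fun do rewrite big_cons; rewrite big_cons; apply: cvgeD => //.
    apply: ge0_adde_def; rewrite inE; first exact: (nnf_ge0 _ (hK a)) hf'.2.
    by rewrite sume_ge0// => i _; exact: (nnf_ge0 _ (hK i)) hf'.2.
  exact: (nnf_cvg _ (hK a)).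
Qed.

(** Continuity along increasing sequences is the monotone convergence theorem applied to
    [s |-> K s (f_ n)]. *)
Lemma nnf_integral d' (S : measurableType d') (mu : {measure set S -> \bar R})
    (D : set S) (K : S -> (T -> \bar R) -> \bar R) :
  measurable D -> (forall s, nnfunctional (K s)) ->
  (forall f, nnmeasurable f -> measurable_fun D (K ^~ f)) ->
  nnfunctional (fun f => \int[mu]_(s in D) K s f).
Proof.
move=> mD hK mK.
have K0 s f : nnmeasurable f -> 0 <= K s f.
  by move=> hf; exact: (nnf_ge0 _ (hK s)) hf.2.
split=> [f f0|f g hf hg fg|f g hf hg|r f r0 hf|f_ f hf hf' nd cf].
- by apply: integral_ge0 => s _; exact: (nnf_ge0 _ (hK s)).
- apply: ge0_le_integral => //; try exact: mK.
  + by move=> s _; exact: K0.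
  + by move=> s _; exact: (nnf_le _ (hK s)).
- under eq_integral do rewrite (nnf_add _ (hK _))//.
  rewrite ge0_integralD//; by [move=> s _; exact: K0|exact: mK].
- under eq_integral do rewrite (nnf_scale _ (hK _))//.
  rewrite ge0_integralZl_EFin//; by [move=> s _; exact: K0|exact: mK].
- rewrite (eq_integral (fun s => limn (fun n => K s (f_ n)))); last first.
    by move=> s _; apply/esym/cvg_lim => //; exact: (nnf_cvg _ (hK s)).
  apply: cvg_monotone_convergence => //.
  + by move=> n; exact: mK.
  + by move=> n s _; exact: K0.
  + by move=> s _ m n mn; apply: (nnf_le _ (hK s)) => // x; exact: nd.
Qed.

End nnfunctional_theory.

(** * Negative binomial series *)

Section negative_binomial.
Context {R : realType}.
Implicit Types (q : R) (n : nat).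

(** Pascal's rule makes the product with [1 - q] telescope: it lowers the order from [n.+1] to [n],
    up to a boundary term that tends to 0. *)
Lemma negative_binomial_partial_sum q n M :
  (1 - q) * (\sum_(0 <= m < M) 'C(m + n.+1, n.+1)%:R * q ^+ m) =
  \sum_(0 <= m < M) 'C(m + n, n)%:R * q ^+ m - 'C(M + n, n.+1)%:R * q ^+ M.
Proof.
elim: M => [|M ih].
  by rewrite !big_geq// mulr0 add0n bin_small// mul0r subr0.
rewrite !big_nat_recr//= mulrDr ih addSn binS addnS binS !natrD exprS.
by ring.
Qed.

(** Induction on [n] from the geometric series; each order costs one factor [(1 - q)^-1] by the
    identity on partial sums. *)
Lemma cvg_negative_binomial q n : 0 <= q < 1 ->
  series (fun m => 'C(m + n, n)%:R * q ^+ m) @ \oo --> (1 - q) ^- n.+1.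
Proof.
move=> /andP[q0 q1]; have q1' : 0 < 1 - q by rewrite subr_gt0.
elim: n => [|n ih].
  have -> : (fun m => 'C(m + 0, 0)%:R * q ^+ m) = geometric 1 q.
    by apply/funext => m /=; rewrite bin0.
  by rewrite expr1 -div1r; apply: cvg_geometric_series; rewrite ger0_norm.
set u := (fun m => 'C(m + n, n)%:R * q ^+ m) in ih.
set v := (fun m => 'C(m + n.+1, n.+1)%:R * q ^+ m).
have v0 m : 0 <= v m by rewrite mulr_ge0// exprn_ge0.
have vE M : series v M = (1 - q)^-1 * (series u M - 'C(M + n, n.+1)%:R * q ^+ M).
  rewrite -negative_binomial_partial_sum mulrA mulVf ?mul1r//.
  by rewrite gt_eqF.
have u0 m : 0 <= u m by rewrite mulr_ge0// exprn_ge0.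
have ndv : nondecreasing_seq (series v) by exact: nondecreasing_series.
have ndu : nondecreasing_seq (series u) by exact: nondecreasing_series.
have cu : cvgn (series u) by apply/cvg_ex; eexists; exact: ih.
(* Dropping the nonnegative boundary term bounds the partial sums by the limit known from the
   induction hypothesis. *)
have cv : cvgn (series v).
  apply: nondecreasing_is_cvgn => //.
  exists ((1 - q)^-1 * lim (series u @ \oo)) => _ [M _ <-].
  rewrite vE; apply: ler_wpM2l; first by rewrite invr_ge0 ltW.
  rewrite lerBlDr (le_trans (nondecreasing_cvgn_le ndu cu M))// lerDl.
  by rewrite mulr_ge0// exprn_ge0.
have v_0 := cvg_series_cvg_0 cv.
have t0 : ('C(M + n, n.+1)%:R * q ^+ M) @[M --> \oo] --> (0 : R).
  (* After a shift by one, the boundary term is [q * v M], and [v M] tends to 0 as the general term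
     of a convergent series. *)
  rewrite -(cvg_shiftS (fun M => 'C(M + n, n.+1)%:R * q ^+ M)) /=.
  rewrite (_ : (fun M => _) = fun M => q * v M); last first.
    by apply/funext => M; rewrite /v exprS addSnnS mulrCA.
  have h : (q * v M) @[M --> \oo] --> q * 0 by apply: cvgM v_0; exact: cvg_cst.
  by rewrite mulr0 in h.
rewrite (_ : series v = fun M =>
    (1 - q)^-1 * (series u M - 'C(M + n, n.+1)%:R * q ^+ M)); last exact/funext.
rewrite exprS invfM; apply: cvgM; first exact: cvg_cst.
by rewrite -[_ ^- _]subr0; apply: cvgB.
Qed.

(* The summands are the law of the number of failures before the [n.+1]-th
   success in Bernoulli trials with success probability [a]. *)
Lemma negative_binomial_sum (a : R) n : 0 < a <= 1 ->
  (\sum_(0 <= m <oo) ('C(m + n, n)%:R * (1 - a) ^+ m * a ^+ n.+1)%:E = 1)%E.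
Proof.
move=> /andP[a0 a1].
have q01 : 0 <= 1 - a < 1 by rewrite subr_ge0 a1/= ltrBlDr ltrDl.
have := cvg_negative_binomial _ n q01; rewrite subKr => h.
apply/cvg_lim => //.
rewrite (_ : (fun k => _) =
    EFin \o (fun k => series (fun m => 'C(m + n, n)%:R * (1 - a) ^+ m) k * a ^+ n.+1)).
  apply: cvg_EFin; first exact: nearW.
  have h2 : (series (fun m => 'C(m + n, n)%:R * (1 - a) ^+ m) k * a ^+ n.+1)
      @[k --> \oo] --> a ^- n.+1 * a ^+ n.+1 by apply: cvgM h _; exact: cvg_cst.
  rewrite mulVf ?expf_neq0 ?gt_eqF// in h2.
apply/funext => k /=; rewrite sumEFin; congr EFin.
by rewrite /series/= mulr_suml.
Qed.

End negative_binomial.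

(** The absorption identity for binomial coefficients. With [m] rejections in all, [m + N] is the
    value of [P_t - 1] and ['C(m + N, N)] counts the ways to spread them over the [N + 1] slots. *)
Lemma bin_predn_ratio {R : numFieldType} (m N : nat) : (0 < N)%N ->
  N%:R / (m + N)%:R * 'C(m + N, N)%:R = 'C(m + N.-1, N.-1)%:R :> R.
Proof.
case: N => // n _ /=; have h := mul_bin_diag (m + n.+1) n.
have h' : (m + n.+1)%:R * 'C(m + n, n)%:R = n.+1%:R * 'C(m + n.+1, n.+1)%:R :> R.
  by rewrite -!natrM -h addnS.
by rewrite mulrAC -h' mulrAC mulfV ?mul1r// pnatr_eq0 addnS.
Qed.

Lemma negative_binomial_weighted_sum {R : realType} (a : R) (n : nat) (g : \bar R) :
  0 < a <= 1 -> (0 <= g)%E ->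
  (\sum_(0 <= m <oo) ('C(m + n, n)%:R * (1 - a) ^+ m * a ^+ n.+1)%:E * g = g)%E.
Proof.
move=> a01 g0; have /andP[a0 a1] := a01.
have b0 m : 0 <= 'C(m + n, n)%:R * (1 - a) ^+ m * a ^+ n.+1.
  by rewrite !mulr_ge0 ?exprn_ge0 ?subr_ge0// ltW.
case: g g0 => [r r0||//].
  under eq_eseriesr do rewrite muleC.
  rewrite nneseriesZl; last by move=> m _; rewrite lee_fin.
  by rewrite negative_binomial_sum// mule1.
(* For [g = +oo] the term of index 0 is already infinite, because [a ^+ n.+1] is positive. *)
move=> _; apply: (@eseries_pinfty _ _ _ 0%N) => //.
  by move=> m _; rewrite gt_eqF// (lt_le_trans ltNy0)// mule_ge0// lee_fin.
by rewrite expr0 binn mul1r mul1r gt0_muley// lte_fin exprn_gt0.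
Qed.

(** * Measurable selection *)

(** On positive reals the inverse is the power of exponent -1, a measurable function. *)
Lemma measurable_inv_gt0 {d} {S : measurableType d} {R : realType} (f : S -> R) :
  (forall s, 0 < f s) -> measurable_fun [set: S] f ->
  measurable_fun [set: S] (fun s => (f s)^-1).
Proof.
move=> f0 mf; rewrite (_ : (fun s => _) = fun s => (f s) `^ (-1)).
  exact: measurableT_comp (measurable_powR _) mf.
by apply/funext => s; rewrite powR_inv1// ltW.
Qed.

Section countable_selection.
Context {d d'} {S : measurableType d} {T : measurableType d'}.

Lemma measurable_fun_nat_level (f : S -> nat) :
  (forall k, measurable [set s | f s = k]) -> measurable_fun [set: S] f.
Proof.
move=> mf _ B _; rewrite setTI.
rewrite (_ : _ @^-1` _ = \bigcup_(k in B) [set s | f s = k]).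
  by apply: bigcup_measurable => k _; exact: mf.
by apply/seteqP; split=> [s Bs|s [k Bk /= ->]]//; exists (f s).
Qed.

(** Split along the countably many values of [k]. This gives the measurability of a particle, the
    proposal at the random index of the first acceptance. *)
Lemma measurable_fun_select (f : nat -> S -> T) (k : S -> nat) :
  (forall j, measurable_fun [set: S] (f j)) -> measurable_fun [set: S] k ->
  measurable_fun [set: S] (fun s => f (k s) s).
Proof.
move=> mf mk _ B mB; rewrite setTI.
rewrite (_ : _ @^-1` _ = \bigcup_j (k @^-1` [set j] `&` f j @^-1` B)).
  apply: bigcup_measurable => j _; apply: measurableI.
    by rewrite -[X in measurable X]setTI; exact: mk.
  by rewrite -[X in measurable X]setTI; exact: mf.
by apply/seteqP; split=> [s Bs|s [j _ [/= <-]]]//; exists (k s).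
Qed.

Lemma first_trueE (b : nat -> bool) j : (exists i, b i) ->
  first_true b = j <-> b j /\ forall i, (i < j)%N -> ~~ b i.
Proof.
move=> eb; rewrite /first_true; case: pselect => // h.
case: ex_minnP => m bm hm; split=> [<-|[bj hj]].
  by split=> // i im; apply/negP => /hm; rewrite leqNgt im.
apply/eqP; rewrite eqn_leq hm//= leqNgt; apply/negP => /hj.
by rewrite bm.
Qed.

Lemma measurable_first_true (b : nat -> S -> bool) :
  (forall j, measurable_fun [set: S] (b j)) ->
  measurable_fun [set: S] (fun s => first_true (b ^~ s)).
Proof.
move=> mb; apply: measurable_fun_nat_level => k.
have mB j c : measurable [set s | b j s = c].
  by rewrite -[X in measurable X]setTI; exact: (mb j measurableT [set c]).
have mex : measurable [set s | exists j, b j s].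
  rewrite (_ : mkset _ = \bigcup_j [set s | b j s = true]).
    by apply: bigcup_measurable => j _; exact: mB.
  by apply/seteqP; split=> [s [j bj]|s [j _ bj]]; exists j.
have mE : measurable ([set s | b k s] `&` [set s | forall i, (i < k)%N -> ~~ b i s]).
  apply: measurableI; first exact: mB.
  rewrite (_ : mkset _ = \bigcap_(i in [set i | (i < k)%N]) [set s | b i s = false]).
    by apply: bigcap_measurableType => i _; exact: mB.
  apply/seteqP; split=> [s h i /= ik|s h i ik]; first exact/negbTE/h.
  by apply/negbT; exact: h.
(* Where [b] never holds, [first_true] has its default value 0, so that piece lies in the level set
   of [k] exactly when [k] is 0. *)
rewrite (_ : mkset _ = ([set s | exists j, b j s] `&`
    ([set s | b k s] `&` [set s | forall i, (i < k)%N -> ~~ b i s])) `|`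
    (~` [set s | exists j, b j s] `&` [set _ | 0%N = k])).
  apply: measurableU; apply: measurableI => //; first exact: measurableC.
  have [k0|k0] := pselect (0%N = k).
    by rewrite (_ : mkset _ = setT)//; apply/seteqP; split.
  by rewrite (_ : mkset _ = set0)//; apply/seteqP; split.
apply/seteqP; split=> s /=.
  case: (pselect (exists j, b j s)) => h.
    by move=> /(first_trueE _ _ h); left.
  by rewrite /first_true; case: pselect => // _ <-; right.
move=> [[h /(first_trueE _ _ h)]//|[h <-]].
by rewrite /first_true; case: pselect.
Qed.

End countable_selection.

(** * The law of one trial *)

Section trial.
Context {dX dY : measure_display} {X : measurableType dX}
  {Y : measurableType dY} {R : realType} {N : nat}.
Variables (M : state_space_model X Y R) (y : nat -> Y) (c : nat -> R).
Implicit Types (t : nat) (xs : 'I_N -> X) (w : 'I_N -> R).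

Lemma measurable_density t :
  measurable_fun [set: X] (fun z => meas_density M t z (y t)).
Proof.
exact: (measurableT_comp (measurable_meas_density M t) (measurable_pair2 (y t))).
Qed.

Definition accept_prob t (x' : X) : R :=
  Num.min 1 (meas_density M t x' (y t) / c t).

Definition clipped_weight t (x' : X) : R :=
  Num.max (meas_density M t x' (y t)) (c t).

Lemma measurable_accept_prob t : measurable_fun [set: X] (accept_prob t).
Proof.
apply: measurable_minr => //; apply: measurable_funM => //.
exact: measurable_density.
Qed.

Lemma measurable_clipped_weight t : measurable_fun [set: X] (clipped_weight t).
Proof. by apply: measurable_maxr => //; exact: measurable_density. Qed.

Lemma accept_prob_ge0 t x' : 0 < c t -> 0 <= accept_prob t x'.
Proof.
by move=> c0; rewrite le_min ler01/= divr_ge0 ?meas_density_ge0 ?ltW.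
Qed.

Lemma accept_prob_le1 t x' : accept_prob t x' <= 1.
Proof. by rewrite ge_min lexx. Qed.

Lemma clipped_weight_ge0 t x' : 0 <= clipped_weight t x'.
Proof. by rewrite le_max meas_density_ge0. Qed.

(** Clipping the weight at the threshold compensates the rejections exactly: below [c] the quotient
    restores the density, above [c] acceptance is certain. *)
Lemma accept_probM t x' : 0 < c t ->
  accept_prob t x' * clipped_weight t x' = meas_density M t x' (y t).
Proof.
move=> c0; rewrite /accept_prob /clipped_weight.
have [gc|gc] := leP (meas_density M t x' (y t)) (c t).
  rewrite min_r ?max_r// ?divfK ?gt_eqF//.
  by rewrite ler_pdivrMr// mul1r.
by rewrite min_l ?mul1r// ler_pdivlMr// mul1r ltW.
Qed.

Lemma nnmeasurable_accept_prob t : 0 < c t ->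
  nnmeasurable (fun x' => (accept_prob t x')%:E).
Proof.
move=> c0; split=> [|x']; last by rewrite lee_fin accept_prob_ge0.
exact/measurable_EFinP/measurable_accept_prob.
Qed.

(* The integral of f against the law of the accepted proposals of one trial,
   a measure whose total mass is the acceptance probability. *)
Definition accept_integral t xs w (f : X -> \bar R) : \bar R :=
  (\sum_(a < N) (w a / \sum_(m < N) w m)%:E *
    \int[trans M t (xs a)]_x' ((accept_prob t x')%:E * f x'))%E.

Lemma normalized_weight_ge0 w a :
  (forall n, 0 <= w n) -> 0 <= w a / \sum_(m < N) w m.
Proof. by move=> w0; rewrite divr_ge0// sumr_ge0. Qed.

Lemma nnf_accept_integral t xs w : 0 < c t -> (forall n, 0 <= w n) ->
  nnfunctional (accept_integral t xs w).
Proof.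
move=> c0 w0; apply: nnf_bigsum => a; apply: nnf_mulc.
  exact: normalized_weight_ge0.
apply: nnf_integral => // [x'|f hf].
  split=> [f f0|f g hf hg fg|f g hf hg|r f r0 hf|f_ f hf hf' nd cf].
  - by rewrite mule_ge0// lee_fin accept_prob_ge0.
  - by rewrite lee_wpmul2l// lee_fin accept_prob_ge0.
  - by rewrite ge0_muleDr//; [exact: hf.2|exact: hg.2].
  - by rewrite muleCA.
  - exact: cvgeZl.
by apply: emeasurable_funM; [exact: (nnmeasurable_accept_prob _ c0).1|exact: hf.1].
Qed.

(** For a positive threshold and nonnegative weights of positive sum, [fine] loses nothing, since
    the mass lies between 0 and 1. *)
Definition acceptance t xs w : R := fine (accept_integral t xs w (cst 1%E)).

Hypothesis hN : (0 < N)%N.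

Lemma sum_normalized_weights w : 0 < \sum_(m < N) w m ->
  \sum_(a < N) w a / \sum_(m < N) w m = 1.
Proof. by move=> s0; rewrite -mulr_suml divff// gt_eqF. Qed.

Lemma trial_law_setT t xs w : 0 < c t -> 0 < \sum_(m < N) w m ->
  trial_law M y c t xs w setT = 1%E.
Proof.
move=> c0 s0; rewrite /trial_law.
rewrite (eq_bigr (fun a => (w a / \sum_(m < N) w m)%:E)); last first.
  move=> a _; rewrite (eq_integral (cst 1%E)); last first.
    move=> x' _; rewrite bernoulli_probE; last first.
      by rewrite accept_prob_ge0//= accept_prob_le1.
    by rewrite !diracT !mule1 -EFinD subrKC.
  by rewrite integral_cst// prob_kernel !mule1.
by rewrite sumEFin sum_normalized_weights.
Qed.

Lemma trial_law_accept t xs w (A : set X) : 0 < c t ->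
  trial_law M y c t xs w [set z : nat * X * bool | z.2 /\ A z.1.2] =
  accept_integral t xs w (fun x' => (\1_A x')%:E).
Proof.
move=> c0; apply: eq_bigr => a _; congr (_ * _)%E; apply: eq_integral => x' _.
rewrite bernoulli_probE; last by rewrite accept_prob_ge0//= accept_prob_le1.
rewrite !diracE indicE (_ : (false \in _) = false) ?mule0 ?adde0; last first.
  by apply/negbTE; rewrite notin_setE/= => -[].
congr (_ * _%:R%:E)%E; congr nat_of_bool.
by apply/idP/idP; rewrite !inE/= => // -[].
Qed.

(** The complement rule, written as a sum so that no extended reals are subtracted. The integrands
    add up to 1, the kernels have mass 1 and the normalized weights sum to 1. *)
Lemma trial_law_reject t xs w : 0 < c t -> (forall n, 0 <= w n) ->
  0 < \sum_(m < N) w m ->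
  (trial_law M y c t xs w [set z : nat * X * bool | ~~ z.2] + accept_integral t xs w (cst 1) = 1)%E.
Proof.
move=> c0 w0 s0; rewrite -big_split/=.
rewrite (eq_bigr (fun a => (w a / \sum_(m < N) w m)%:E)); last first.
  move=> a _; rewrite -ge0_muleDr; last 2 first.
  - by apply: integral_ge0.
  - by apply: integral_ge0 => x' _; rewrite mule1 lee_fin accept_prob_ge0.
  rewrite -[RHS]mule1; congr (_ * _)%E.
  rewrite (eq_integral (fun x' => (1 - accept_prob t x')%:E)); last first.
    move=> x' _; rewrite bernoulli_probE; last first.
      by rewrite accept_prob_ge0//= accept_prob_le1.
    rewrite !diracE (_ : (true \in _) = false) ?mule0 ?add0e; last first.
      by apply/negbTE; rewrite notin_setE/=.
    by rewrite mem_set//= mule1.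
  rewrite -ge0_integralD//.
  - under eq_integral do rewrite mule1 -EFinD subrK.
    by rewrite integral_cst// prob_kernel mule1.
  - by move=> x' _; rewrite lee_fin subr_ge0 accept_prob_le1.
  - apply/measurable_EFinP; apply: measurable_funB => //.
    exact: measurable_accept_prob.
  - by move=> x' _; rewrite mule1 lee_fin accept_prob_ge0.
  - under eq_fun do rewrite mule1.
    exact: (nnmeasurable_accept_prob _ c0).1.
by rewrite sumEFin sum_normalized_weights.
Qed.

Lemma accept_integral1 t xs w : 0 < c t -> (forall n, 0 <= w n) ->
  0 < \sum_(m < N) w m ->
  [/\ accept_integral t xs w (cst 1%E) = (acceptance t xs w)%:E,
      0 <= acceptance t xs w <= 1 &
      trial_law M y c t xs w [set z : nat * X * bool | ~~ z.2] = (1 - acceptance t xs w)%:E].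
Proof.
move=> c0 w0 s0; have h := trial_law_reject t xs w c0 w0 s0.
have a0 : (0 <= accept_integral t xs w (cst 1))%E.
  exact: (nnf_ge0 _ (nnf_accept_integral t xs w c0 w0)).
have r0 : (0 <= trial_law M y c t xs w [set z : nat * X * bool | ~~ z.2])%E.
  rewrite /trial_law sume_ge0// => a _.
  by rewrite mule_ge0// ?lee_fin ?normalized_weight_ge0//; exact: integral_ge0.
have a1 : (accept_integral t xs w (cst 1) <= 1)%E.
  by rewrite -[leRHS]h leeDr.
have afin : accept_integral t xs w (cst 1%E) \is a fin_num.
  by rewrite ge0_fin_numE// (le_lt_trans a1 (ltry 1)).
have rfin : trial_law M y c t xs w [set z : nat * X * bool | ~~ z.2] \is a fin_num.
  rewrite ge0_fin_numE// (le_lt_trans _ (ltry 1))// -[leRHS]h.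
  exact: leeDl.
have aE : accept_integral t xs w (cst 1%E) = (acceptance t xs w)%:E.
  by rewrite /acceptance fineK.
have rE : trial_law M y c t xs w [set z : nat * X * bool | ~~ z.2] = (1 - acceptance t xs w)%:E.
  rewrite -[LHS]fineK//; congr EFin.
  by move: h; rewrite aE -[X in (X + _)%E]fineK// -EFinD => -[<-]; rewrite addrK.
by split=> //; rewrite -!lee_fin -aE a0.
Qed.

(** A measure of total mass 0 integrates everything to 0. This settles the outcomes at which no
    trial can be accepted. *)
Lemma accept_integral_eq0 t xs w f : 0 < c t -> (forall n, 0 <= w n) ->
  0 < \sum_(m < N) w m -> acceptance t xs w = 0 -> nnmeasurable f ->
  accept_integral t xs w f = 0%E.
Proof.
move=> c0 w0 s0 a0 hf; have hI := nnf_accept_integral t xs w c0 w0.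
have [aE _ _] := accept_integral1 t xs w c0 w0 s0.
apply: (eq_nnfunctional _ (fun=> 0%E) hI _ _ f hf).
- split=> // [f1 f2 _ _|r f1 _ _|*]; [by rewrite adde0|by rewrite mule0|exact: cvg_cst].
- move=> A mA; apply/eqP; rewrite eq_le.
  rewrite (nnf_ge0 _ hI) ?andbT; last by move=> x'; rewrite lee_fin.
  rewrite -[leRHS](congr1 EFin a0) -aE; apply: (nnf_le _ hI).
  + exact: nnmeasurable_indic.
  + exact: nnmeasurable1.
  + by move=> x'; rewrite lee_fin indicE lern1 leq_b1.
Qed.

Lemma nnmeasurable_likelihood_from k t : nnmeasurable (likelihood_from M y k t).
Proof.
elim: k t => [|k ih] t /=; first by split=> // x'; rewrite lee_fin ler01.
have h : nnmeasurable (fun x' => (meas_density M t.+1 x' (y t.+1))%:E *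
    likelihood_from M y k t.+1 x')%E.
  apply: nnmeasurableM (ih _); split=> [|x'].
    exact/measurable_EFinP/measurable_density.
  by rewrite lee_fin meas_density_ge0.
split=> [|x']; last by apply: integral_ge0 => z _; exact: h.2.
apply: measurable_fun_integral_kernel => //; [|exact: h.2|exact: h.1].
by move=> U mU; exact: measurable_kernel.
Qed.

(** By [accept_probM] the integrand is the density times the remaining likelihood, which is the
    recursion of [likelihood_from]. *)
Lemma accept_integral_likelihood k t xs w : 0 < c t.+1 ->
  accept_integral t.+1 xs w
    (fun x' => (clipped_weight t.+1 x')%:E * likelihood_from M y k t.+1 x')%E =
  (\sum_(a < N) (w a / \sum_(m < N) w m)%:E * likelihood_from M y k.+1 t (xs a))%E.
Proof.
move=> c0; apply: eq_bigr => a _; congr (_ * _)%E; apply: eq_integral => x' _.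
by rewrite muleA -EFinM accept_probM.
Qed.

Lemma measurable_accept_integral {d} {S : measurableType d} t
    (xs : 'I_N -> S -> X) (w : 'I_N -> S -> R) f : 0 < c t ->
  (forall n, measurable_fun [set: S] (xs n)) ->
  (forall n, measurable_fun [set: S] (w n)) ->
  (forall n s, 0 < w n s) -> nnmeasurable f ->
  measurable_fun [set: S] (fun s => accept_integral t (xs ^~ s) (w ^~ s) f).
Proof.
move=> c0 mx mw w0 hf.
have s0 s : 0 < \sum_(m < N) w m s.
  case: N hN w w0 {xs mx mw} => // n _ w w0.
  by rewrite big_ord_recl ltr_pwDl// sumr_ge0// => i _; exact: ltW.
apply: emeasurable_sum => a; apply: emeasurable_funM.
  apply/measurable_EFinP; apply: measurable_funM => //.
  have ms : measurable_fun [set: S] (fun s => \sum_(m < N) w m s) by exact: measurable_sum.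
  exact: measurable_inv_gt0 s0 ms.
have h := nnmeasurableM _ _ (nnmeasurable_accept_prob _ c0) hf.
have mI : measurable_fun [set: X]
    (fun z => \int[trans M t z]_x' ((accept_prob t x')%:E * f x'))%E.
  apply: measurable_fun_integral_kernel => //; [|exact: h.2|exact: h.1].
  by move=> U mU; exact: measurable_kernel.
exact: measurableT_comp mI (mx a).
Qed.

End trial.

(** * Measurability with respect to the history *)

Section run.
Context {dX dO : measure_display} {X : measurableType dX}
  {Omega : measurableType dO} {R : realType} {P : probability Omega R} {N : nat}.
Variable W : pf_run X P N.
Implicit Types (t s : nat) (om : Omega) (k : 'I_N.+1 -> nat).

Definition history_gen t : set (set Omega) :=
  [set A | (exists n B, measurable B /\ A = x0 W n @^-1` B) \/
    (exists s n j B, [/\ (1 <= s <= t)%N, measurable B &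
                         A = trial W s n j @^-1` B])].

(** [Omega] with the sigma-algebra of the past, so that adaptedness to [history] is ordinary
    measurability on this type. *)
Definition historyT t := g_sigma_algebraType (history_gen t).

Lemma history_measurable t (A : set Omega) : history W t A -> measurable A.
Proof.
apply: smallest_sub; first exact: sigma_algebra_measurable.
by move=> _ [[n [B [mB ->]]]|[s [n [j [B [_ mB ->]]]]]];
  rewrite -[X in measurable X]setTI; exact: measurable_funP.
Qed.

Lemma measurable_fun_historyT t {d} {U : measurableType d} (f : Omega -> U) :
  measurable_fun [set: historyT t] f -> measurable_fun [set: Omega] f.
Proof.
move=> mf _ B mB; rewrite setTI; apply: (@history_measurable t).
by have := mf measurableT B mB; rewrite setTI.
Qed.

Lemma measurable_trial t s n j : (1 <= s <= t)%N ->
  measurable_fun [set: historyT t] (trial W s n j).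
Proof.
move=> st _ B mB; rewrite setTI; apply: sub_sigma_algebra.
by right; exists s, n, j, B.
Qed.

Lemma measurable_accepted t s n j : (1 <= s <= t)%N ->
  measurable_fun [set: historyT t] (accepted W s n j).
Proof. by move=> st; exact: measurableT_comp (measurable_trial _ _ n j st). Qed.

Lemma measurable_proposal t s n j : (1 <= s <= t)%N ->
  measurable_fun [set: historyT t] (proposal W s n j).
Proof.
move=> st; apply: measurableT_comp measurable_snd _.
exact: measurableT_comp measurable_fst (measurable_trial _ _ n j st).
Qed.

Lemma measurable_first_accepted t s n : (1 <= s <= t)%N ->
  measurable_fun [set: historyT t] (first_accepted W s n).
Proof.
by move=> st; apply: measurable_first_true => j; exact: measurable_accepted.
Qed.

Lemma measurable_particle t s n : (s <= t)%N ->
  measurable_fun [set: historyT t] (particle W s n).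
Proof.
case: s => [_|s st].
  move=> _ B mB; rewrite setTI; apply: sub_sigma_algebra.
  by left; exists n, B.
apply: measurable_fun_select => [j|]; first exact: measurable_proposal.
exact: measurable_first_accepted.
Qed.

Lemma alive0 : alive W 0 = setT.
Proof.
by rewrite predeqE => om; split=> // _ s /andP[s1 s0]; move: (leq_trans s1 s0).
Qed.

Lemma aliveS t :
  alive W t.+1 = alive W t `&` [set om | forall n, terminates W t.+1 n om].
Proof.
apply/seteqP; split=> [om h|om [h1 h2] s /andP[s1]].
  split=> [s /andP[s1 st] n|n]; apply: h; last by rewrite leqnn.
  by rewrite s1 ltnW.
by rewrite leq_eqVlt => /predU1P[->|st]; [exact: h2|apply: h1; rewrite s1].
Qed.

Lemma measurable_terminates t s n : (1 <= s <= t)%N ->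
  measurable ([set om | terminates W s n om] : set (historyT t)).
Proof.
move=> st; rewrite (_ : mkset _ = \bigcup_j (accepted W s n j @^-1` [set true])).
  apply: bigcup_measurable => j _; rewrite -[X in measurable X]setTI.
  exact: (measurable_accepted t s n j st measurableT [set true]).
by apply/seteqP; split=> [om [j aj]|om [j _ aj]]; exists j.
Qed.

Lemma measurable_alive t s : (s <= t)%N ->
  measurable (alive W s : set (historyT t)).
Proof.
elim: s => [_|s ih st]; first by rewrite alive0; exact: measurableT.
rewrite aliveS; apply: measurableI; first by apply: ih; exact: ltnW.
rewrite (_ : mkset _ = \bigcap_(n in [set: 'I_N.+1]) [set om | terminates W s.+1 n om]).
  by apply: fin_bigcap_measurable => [|n _]; first exact: finite_finset;
    exact: measurable_terminates.
by apply/seteqP; split=> [om h n _|om h n]; exact: h.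
Qed.

(** An event about finitely many trials, hence within reach of the product formula in [is_pfrc].
    These events partition the outcomes at which all slots terminate. *)
Definition first_at t k : set Omega :=
  [set om | forall n, accepted W t n (k n) om /\
                     forall j, (j < k n)%N -> ~~ accepted W t n j om].

Lemma first_at_terminates t k om n : first_at t k om -> terminates W t n om.
Proof. by move=> h; exists (k n); have [] := h n. Qed.

Lemma first_at_first_accepted t k om n :
  first_at t k om -> first_accepted W t n om = k n.
Proof.
move=> h; apply/first_trueE; first exact: first_at_terminates h.
exact: (h n).
Qed.

Lemma terminates_first_at t om : (forall n, terminates W t n om) ->
  first_at t (fun n => first_accepted W t n om) om.
Proof. by move=> h n; exact: ((first_trueE _ _ (h n)).1 erefl). Qed.

Lemma measurable_first_at t k : (1 <= t)%N ->
  measurable (first_at t k : set (historyT t)).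
Proof.
move=> t1; have tt : (1 <= t <= t)%N by rewrite t1 leqnn.
rewrite (_ : first_at t k = \bigcap_(n in [set: 'I_N.+1])
  (accepted W t n (k n) @^-1` [set true] `&`
   \bigcap_(j in [set j | (j < k n)%N]) (accepted W t n j @^-1` [set false]))).
  have ma n j b : measurable (accepted W t n j @^-1` [set b] : set (historyT t)).
    rewrite -[X in measurable X]setTI.
    exact: (measurable_accepted t t n j tt measurableT [set b]).
  apply: fin_bigcap_measurable => [|n _]; first exact: finite_finset.
  apply: measurableI; first exact: ma.
  by apply: bigcap_measurableType => j _; exact: ma.
apply/seteqP; split=> om h n.
  by move=> _; split; [exact: (h n).1|move=> j jk /=; apply/negbTE/(h n).2].
have [/= h1 h2] := h n Logic.I; split=> // j jk.
by rewrite (h2 j jk).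
Qed.

(** Each of the [N + 1] slots has one accepted trial besides its rejections; subtracting 1 leaves
    the rejections plus [N]. *)
Lemma propagationsE t om : (propagations W t om)%:R - 1 =
  ((\sum_(n < N.+1) first_accepted W t n om) + N)%N%:R :> R.
Proof.
rewrite /propagations; under eq_bigr do rewrite -addn1.
by rewrite big_split/= sum1_card card_ord addnS -natr1 addrK.
Qed.

Hypothesis hN : (0 < N)%N.

Lemma propagationsB1_gt0 t om : 0 < (propagations W t om)%:R - 1 :> R.
Proof. by rewrite propagationsE ltr0n addn_gt0 hN orbT. Qed.

Lemma measurable_propagations t s : (1 <= s <= t)%N ->
  measurable_fun [set: historyT t] (fun om => ((propagations W s om)%:R - 1)^-1 : R).
Proof.
move=> st; apply: measurable_inv_gt0.
  by move=> om; exact: propagationsB1_gt0.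
apply: measurable_funB => //.
rewrite (_ : (fun om => _) = fun om => \sum_(n < N.+1) (first_accepted W s n om).+1%:R).
  apply: measurable_sum => n.
  have mS : measurable_fun [set: nat] (fun m => m.+1%:R : R) by [].
  exact: measurableT_comp mS (measurable_first_accepted _ _ _ st).
by apply/funext => om; rewrite /propagations natr_sum.
Qed.

End run.

(** * The conditional law of the trials *)

(** The trials of one slot: [k] rejections of probability [r], one accepted trial of probability
    [s], and [d] unconstrained trials. *)
Lemma prod_first_success {R : realDomainType} (r : R) (s : \bar R) (k d : nat) :
  (\prod_(j < k + d.+1)
    (if (j < k)%N then r%:E else if j == k :> nat then s else 1) =
  (r ^+ k)%:E * s)%E.
Proof.
rewrite big_split_ord/= big_ord_recl/= addn0 ltnn eqxx.
rewrite [X in (_ * (_ * X))%E]big1 ?mule1; last first.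
  by move=> i _; rewrite ltnNge leq_addr/= -[X in _ == X]addn0 eqn_add2l.
congr (_ * _)%E; rewrite (eq_bigr (fun=> r%:E)); last by move=> i _; rewrite ltn_ord.
by rewrite prodEFin prodr_const card_ord.
Qed.

Section conditional_step.
Context {dX dY dO : measure_display} {X : measurableType dX}
  {Y : measurableType dY} {Omega : measurableType dO} {R : realType}
  {P : probability Omega R} {T N : nat}.
Variables (M : state_space_model X Y R) (y : nat -> Y) (c : nat -> R).
Variable W : pf_run X P N.
Hypotheses (hN : (0 < N)%N) (hc : forall t, (1 <= t <= T)%N -> 0 < c t)
  (hW : is_pfrc M y c W T).
Implicit Types (t s : nat) (om : Omega) (k : 'I_N.+1 -> nat).

(** Weights are 1 at time 0 and at least a positive threshold afterwards, so normalization never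
    divides by 0. *)
Lemma weight_gt0 t n om : (t <= T)%N -> 0 < weight M y c W t n om.
Proof.
case: t => [|t] tT; first exact: ltr01.
by rewrite /weight lt_max (hc t.+1) ?orbT.
Qed.

Lemma measurable_weight t s n : (s <= t)%N ->
  measurable_fun [set: historyT W t] (weight M y c W s n).
Proof.
case: s => [_|s st]; first exact: measurable_cst.
exact: measurableT_comp (measurable_clipped_weight M y c s.+1)
  (measurable_particle W t s.+1 n st).
Qed.

Lemma sum_weight_gt0 t om : (t <= T)%N ->
  0 < \sum_(n < N) weight M y c W t n om.
Proof.
move=> tT; rewrite (bigD1 (Ordinal hN))//= ltr_pwDl ?weight_gt0//.
by rewrite sumr_ge0// => i _; rewrite ltW// weight_gt0.
Qed.

Definition acceptance_at t om : R :=
  acceptance M y c t.+1 (particle W t ^~ om) (weight M y c W t ^~ om).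

Definition accept_integral_at t om : (X -> \bar R) -> \bar R :=
  accept_integral M y c t.+1 (particle W t ^~ om) (weight M y c W t ^~ om).

(** The exponent is [N] and not [N + 1]: the acceptance of the slot whose proposal is observed is
    accounted for by [accept_integral_at]. *)
Definition first_at_prob t m om : R :=
  (1 - acceptance_at t om) ^+ m * acceptance_at t om ^+ N.

(** * Rejection counts and accepted proposals at one time step *)

Section at_time.
Variable t : nat.
Hypothesis tT : (t < T)%N.

Let ct : 0 < c t.+1. Proof. exact: hc. Qed.

Let w0 om n : 0 < weight M y c W t n om.
Proof. by apply: weight_gt0; exact: ltnW. Qed.

Let sw0 om : 0 < \sum_(n < N) weight M y c W t n om.
Proof. by apply: sum_weight_gt0; exact: ltnW. Qed.

Let nnI om : nnfunctional (accept_integral_at t om).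
Proof. by apply: nnf_accept_integral => // n; exact: ltW. Qed.

Let accE om : accept_integral_at t om (cst 1%E) = (acceptance_at t om)%:E.
Proof. by have [] := accept_integral1 M y c t.+1
   (particle W t ^~ om) (weight M y c W t ^~ om) ct (fun n => ltW (w0 om n)) (sw0 om). Qed.

Let acc01 om : 0 <= acceptance_at t om <= 1.
Proof. by have [] := accept_integral1 M y c t.+1
   (particle W t ^~ om) (weight M y c W t ^~ om) ct (fun n => ltW (w0 om n)) (sw0 om). Qed.

Let rejE om : trial_law M y c t.+1 (particle W t ^~ om) (weight M y c W t ^~ om)
  [set z : nat * X * bool | ~~ z.2] = (1 - acceptance_at t om)%:E.
Proof. by have [] := accept_integral1 M y c t.+1
   (particle W t ^~ om) (weight M y c W t ^~ om) ct (fun n => ltW (w0 om n)) (sw0 om). Qed.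

Lemma first_at_prob_ge0 m om : 0 <= first_at_prob t m om.
Proof. by have /andP[a0 a1] := acc01 om; rewrite mulr_ge0 ?exprn_ge0 ?subr_ge0. Qed.

Lemma accept_integral_at_ge0 om f : nnmeasurable f ->
  (0 <= accept_integral_at t om f)%E.
Proof. by move=> hf; apply: (nnf_ge0 _ (nnI om)); exact: hf.2. Qed.

(** Bounded by the total mass. Finiteness allows this integral to be used as a real factor. *)
Lemma accept_integral_at_indic_fin om (A : set X) : measurable A ->
  accept_integral_at t om (fun x => (\1_A x)%:E) \is a fin_num.
Proof.
move=> mA; have iA := nnmeasurable_indic A mA : nnmeasurable (fun x => (\1_A x)%:E : \bar R).
rewrite ge0_fin_numE ?accept_integral_at_ge0//.
rewrite (@le_lt_trans _ _ (acceptance_at t om)%:E) ?ltry// -accE.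
apply: (nnf_le _ (nnI om) _ _ iA nnmeasurable1) => x.
by rewrite lee_fin indicE lern1 leq_b1.
Qed.

Lemma measurable_accept_integral_at f : nnmeasurable f ->
  measurable_fun [set: historyT W t] (fun om => accept_integral_at t om f).
Proof.
move=> hf; apply: measurable_accept_integral => //.
  by move=> n; exact: measurable_particle.
by move=> n; exact: measurable_weight.
Qed.

Lemma measurable_first_at_prob m :
  measurable_fun [set: historyT W t] (first_at_prob t m).
Proof.
have ma : measurable_fun [set: historyT W t] (acceptance_at t).
  apply: measurableT_comp; first exact: fine_measurable.
  apply: measurable_accept_integral_at; exact: nnmeasurable1.
apply: measurable_funM; last exact: measurable_funX.
by apply: measurable_funX; exact: measurable_funB.
Qed.

Let rejected : set (nat * X * bool) := [set z : nat * X * bool | ~~ z.2].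
Let accepted_in (A : set X) : set (nat * X * bool) := [set z : nat * X * bool | z.2 /\ A z.1.2].

Let measurable_rejected : measurable rejected.
Proof.
rewrite (_ : rejected = setT `&` snd @^-1` [set false]).
  exact: (@measurable_snd _ _ (nat * X)%type bool measurableT [set false] I).
by rewrite setTI; apply/seteqP; split=> -[z []].
Qed.

Let measurable_accepted_in A : measurable A -> measurable (accepted_in A).
Proof.
move=> mA; apply: measurableI.
  rewrite -[X in measurable X]setTI.
  exact: (@measurable_snd _ _ (nat * X)%type bool measurableT [set true] I).
rewrite -[X in measurable X]setTI.
have m12 : measurable_fun [set: nat * X * bool] (fun z : nat * X * bool => z.1.2).
  exact: measurableT_comp measurable_snd measurable_fst.
exact: m12.
Qed.

(** The event is a rectangle in the first [J] trials of all slots, so its conditional probability is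
    a product of one-trial probabilities. *)
Lemma first_at_law (H : set Omega) (A : set X) k (n0 : 'I_N.+1) :
  history W t H -> H `<=` alive W t -> measurable A ->
  P (H `&` (first_at W t.+1 k `&` proposal W t.+1 n0 (k n0) @^-1` A)) =
  (\int[P]_(om in H) ((first_at_prob t (\sum_n k n) om)%:E *
     accept_integral_at t om (fun x => (\1_A x)%:E)))%E.
Proof.
(* A common horizon beyond every [k n]. The set [An n] below constrains the accepted proposal of
   slot [n0] only. *)
move=> hH Ha mA; pose J := (\sum_n k n).+1.
pose An n := if n == n0 then A else setT.
have mAn n : measurable (An n) by rewrite /An; case: ifP.
pose B (n : 'I_N.+1) j := if (j < k n)%N then rejected
  else if j == k n then accepted_in (An n) else setT.
have mB n j : measurable (B n j).
  by rewrite /B; case: ifP => _ //; case: ifP => _ //; exact: measurable_accepted_in.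
have kJ n : (k n < J)%N by rewrite ltnS (bigD1 n)//= leq_addr.
rewrite (_ : first_at _ _ _ `&` _ =
    [set om | forall n j, (j < J)%N -> B n j (trial W t.+1 n j om)]); last first.
  apply/seteqP; split=> [om [h1 h2] n j jJ|om h].
    have [an rn] := h1 n.
    rewrite /B; case: ifPn => jk; first exact: rn.
    case: eqVneq => // ->; split=> //; rewrite /An; case: eqVneq => // ->.
    exact: h2.
  split=> [n|].
    split=> [|j jk].
      by have := h n _ (kJ n); rewrite /B ltnn eqxx => -[].
    by have := h n _ (ltn_trans jk (kJ n)); rewrite /B jk.
  by have := h n0 _ (kJ n0); rewrite /B ltnn eqxx /An eqxx => -[].
have [_ /(_ t tT _ hH Ha J B mB) ->] := hW.
apply: eq_integral => om _.
have prodn n : (\prod_(j < J) trial_law M y c t.+1 (particle W t ^~ om)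
      (weight M y c W t ^~ om) (B n j) =
    ((1 - acceptance_at t om) ^+ k n)%:E *
      accept_integral_at t om (fun x => (\1_(An n) x)%:E))%E.
  have -> : J = (k n + (J - (k n).+1).+1)%N by rewrite -subSn// subSS subnKC// ltnW.
  rewrite -(prod_first_success _ _ _ (J - (k n).+1)); apply: eq_bigr => j _; rewrite /B.
  case: ifP => _; first exact: rejE.
  by case: ifP => _; [rewrite trial_law_accept|rewrite trial_law_setT].
rewrite (eq_bigr _ (fun n _ => prodn n)) big_split/= prodEFin -expr_sum.
(* Slot [n0] keeps the integral of the indicator of [A]; each of the other [N] slots contributes the
   full acceptance probability. *)
rewrite [X in (_ * X = _)%E](bigD1 n0)//= (_ : An n0 = A); last by rewrite /An eqxx.
rewrite (eq_bigr (fun=> (acceptance_at t om)%:E)); last first.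
  move=> n /negbTE nn0; rewrite /An nn0 -accE; congr (accept_integral_at _ _ _).
  by apply/funext => x; rewrite indicT.
rewrite prodEFin prodr_const cardC1 card_ord /first_at_prob EFinM -muleA.
by congr (_ * _)%E; rewrite muleC.
Qed.

(** First extension, in the past: for fixed [A] both sides are monotone functionals of [F], and on
    indicators of history events they agree by [first_at_law]. *)
Lemma first_at_integral_indic (A : set X) k (n0 : 'I_N.+1) (F : Omega -> \bar R) :
  measurable A -> nnmeasurable (F : historyT W t -> \bar R) ->
  (\int[P]_(om in alive W t `&` (first_at W t.+1 k `&`
      proposal W t.+1 n0 (k n0) @^-1` A)) F om =
  \int[P]_(om in alive W t) ((first_at_prob t (\sum_n k n) om *
     fine (accept_integral_at t om (fun x => (\1_A x)%:E)))%:E * F om))%E.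
Proof.
move=> mA hF.
have malive : history W t (alive W t) by exact: measurable_alive.
have malive' := history_measurable _ _ _ malive.
have mD : measurable (alive W t `&` (first_at W t.+1 k `&`
    proposal W t.+1 n0 (k n0) @^-1` A)).
  apply: measurableI => //; apply: measurableI.
    exact: history_measurable (measurable_first_at _ _ _ _).
  rewrite -[X in measurable X]setTI.
  by apply: (measurable_fun_historyT W t.+1) => //; apply: measurable_proposal;
    rewrite ltnSn.
have iA := nnmeasurable_indic A mA : nnmeasurable (fun x => (\1_A x)%:E : \bar R).
have finI om := accept_integral_at_indic_fin om A mA.
have K0 om : 0 <= first_at_prob t (\sum_n k n) om *
     fine (accept_integral_at t om (fun x => (\1_A x)%:E)).
  by rewrite mulr_ge0 ?first_at_prob_ge0// fine_ge0// accept_integral_at_ge0.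
have mK : measurable_fun [set: historyT W t] (fun om =>
    first_at_prob t (\sum_n k n) om *
     fine (accept_integral_at t om (fun x => (\1_A x)%:E))).
  apply: measurable_funM; first exact: measurable_first_at_prob.
  apply: measurableT_comp; first exact: fine_measurable.
  exact: measurable_accept_integral_at.
apply: (eq_nnfunctional (fun f : historyT W t -> \bar R =>
    \int[P]_(om in alive W t `&` (first_at W t.+1 k `&`
      proposal W t.+1 n0 (k n0) @^-1` A)) f om)%E
  (fun f : historyT W t -> \bar R =>
    \int[P]_(om in alive W t) ((first_at_prob t (\sum_n k n) om *
     fine (accept_integral_at t om (fun x => (\1_A x)%:E)))%:E * f om))%E) hF.
- apply: nnf_integral => // f [mf _].
  by apply: measurable_funTS; exact: measurable_fun_historyT mf.
- apply: nnf_integral => // [om|f [mf _]].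
    by apply: nnf_mulc => //; exact: nnf_eval.
  apply: measurable_funTS; apply: (measurable_fun_historyT W t).
  by apply: emeasurable_funM => //; exact/measurable_EFinP.
(* The law is applied to [H] cut down to [alive], as the conditional law of the trials is given only
   on such events. *)
- move=> H mH; rewrite integral_indic//; last exact: history_measurable mH.
  rewrite setIA; etransitivity.
    apply: first_at_law => //.
    exact: (@measurableI _ (historyT W t) H _ mH malive).
  rewrite [in LHS]setIC integral_mkcondr; apply: eq_integral => om _.
  rewrite /patch indicE; case: ifPn => _; last by rewrite mule0.
  by rewrite mule1 [in RHS]EFinM fineK.
Qed.

(** Second extension, in the proposal: now [F] is fixed and both sides are monotone functionals of
    [phi]. *)
Lemma first_at_integral (phi : X -> \bar R) k (n0 : 'I_N.+1) (F : Omega -> R) :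
  nnmeasurable phi -> measurable_fun [set: historyT W t] F ->
  (forall om, 0 <= F om) ->
  (\int[P]_(om in alive W t `&` first_at W t.+1 k)
      ((F om)%:E * phi (proposal W t.+1 n0 (k n0) om)) =
  \int[P]_(om in alive W t) ((F om * first_at_prob t (\sum_n k n) om)%:E *
     accept_integral_at t om phi))%E.
Proof.
move=> hphi mF F0.
have malive := history_measurable _ _ _ (measurable_alive W t t (leqnn t)).
have mD : measurable (alive W t `&` first_at W t.+1 k).
  apply: measurableI => //.
  exact: history_measurable (measurable_first_at _ _ _ _).
have mprop : measurable_fun [set: Omega] (proposal W t.+1 n0 (k n0)).
  apply: (measurable_fun_historyT W t.+1); apply: measurable_proposal.
  by rewrite ltnSn.
have mFp : measurable_fun [set: historyT W t]
    (fun om => F om * first_at_prob t (\sum_n k n) om).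
  by apply: measurable_funM => //; exact: measurable_first_at_prob.
apply: (eq_nnfunctional (fun f : X -> \bar R =>
    \int[P]_(om in alive W t `&` first_at W t.+1 k)
      ((F om)%:E * f (proposal W t.+1 n0 (k n0) om)))%E
  (fun f : X -> \bar R =>
    \int[P]_(om in alive W t) ((F om * first_at_prob t (\sum_n k n) om)%:E *
     accept_integral_at t om f))%E) hphi.
- apply: nnf_integral => // [om|f [mf _]].
    by apply: nnf_mulc => //; exact: nnf_eval.
  apply: measurable_funTS; apply: emeasurable_funM.
    by apply/measurable_EFinP; exact: measurable_fun_historyT mF.
  exact: measurableT_comp mf mprop.
- apply: nnf_integral => // [om|f hf].
    by apply: nnf_mulc => //; rewrite mulr_ge0// first_at_prob_ge0.
  apply: measurable_funTS; apply: (measurable_fun_historyT W t).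
  apply: emeasurable_funM; first exact/measurable_EFinP.
  exact: measurable_accept_integral_at.
- move=> A mA.
  (* The indicator of [A] at the proposal becomes a restriction of the domain, as in the first
     extension. *)
  transitivity (\int[P]_(om in alive W t `&` (first_at W t.+1 k `&`
      proposal W t.+1 n0 (k n0) @^-1` A)) (F om)%:E)%E.
    rewrite setIA [RHS]integral_mkcondr; apply: eq_integral => om _.
    rewrite /patch indicE /=; case: ifPn => [|/negbTE] h.
      by move: h; rewrite inE /= => /mem_set ->; rewrite mule1.
    move: h; rewrite (_ : (om \in _) = (proposal W t.+1 n0 (k n0) om \in A)).
      by move=> ->; rewrite mule0.
    by apply/idP/idP; rewrite !inE.
  rewrite (first_at_integral_indic _ _ _ (EFin \o F))//; last first.
    by split=> [|om]; [exact/measurable_EFinP|rewrite lee_fin].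
  apply: eq_integral => om _ /=.
  rewrite (EFinM (first_at_prob _ _ _) (fine _)) fineK.
    by rewrite (EFinM (F om)) muleC muleA.
  exact: accept_integral_at_indic_fin.
Qed.

End at_time.
End conditional_step.

(** * The martingale property *)

Section unbiasedness.
Context {dX dY dO : measure_display} {X : measurableType dX}
  {Y : measurableType dY} {Omega : measurableType dO} {R : realType}
  {P : probability Omega R} {T N : nat}.
Variables (M : state_space_model X Y R) (y : nat -> Y) (c : nat -> R).
Variable W : pf_run X P N.
Hypotheses (hN : (0 < N)%N) (hc : forall t, (1 <= t <= T)%N -> 0 < c t)
  (hW : is_pfrc M y c W T).

(** The estimator without its termination test; on [alive] its value at time [T] is [Zhat]. *)
Definition Z_until (t : nat) (om : Omega) : R :=
  \prod_(1 <= s < t.+1)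
    ((\sum_(n < N) weight M y c W s n om) / ((propagations W s om)%:R - 1)).

Definition expected_likelihood (K t : nat) (om : Omega) : \bar R :=
  (\sum_(n < N) (weight M y c W t n om / \sum_(m < N) weight M y c W t m om)%:E *
    likelihood_from M y K t (particle W t n om))%E.

Lemma weight_ge0 t n om : 0 <= weight M y c W t n om.
Proof.
by case: t => [|t]; [exact: ler01|rewrite /weight le_max meas_density_ge0].
Qed.

Lemma Z_until_ge0 t om : 0 <= Z_until t om.
Proof.
apply: prodr_ge0 => s _; apply: divr_ge0; last exact/ltW/propagationsB1_gt0.
by apply: sumr_ge0 => n _; exact: weight_ge0.
Qed.

Lemma measurable_Z_until t : measurable_fun [set: historyT W t] (Z_until t).
Proof.
apply: measurable_prod => s; rewrite mem_index_iota ltnS => st.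
apply: measurable_funM; last exact: measurable_propagations.
apply: measurable_sum => n; apply: measurable_weight.
by have /andP[] := st.
Qed.

Lemma nnmeasurable_expected_likelihood K t : (t <= T)%N ->
  nnmeasurable (expected_likelihood K t : historyT W t -> \bar R).
Proof.
move=> tT; split=> [|om]; last first.
  apply: sume_ge0 => n _; apply: mule_ge0.
    by rewrite lee_fin normalized_weight_ge0// => i; exact: weight_ge0.
  exact: (nnmeasurable_likelihood_from M y K t).2.
apply: emeasurable_sum => n; apply: emeasurable_funM.
  apply/measurable_EFinP; apply: measurable_funM; first exact: measurable_weight.
  apply: measurable_inv_gt0 => [om|]; first exact: (sum_weight_gt0 _ _ _ _ hN hc).
  by apply: measurable_sum => m; exact: measurable_weight.
exact: measurableT_comp (nnmeasurable_likelihood_from M y K t).1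
  (measurable_particle W t t n (leqnn t)).
Qed.

(** * The step from time t to time t + 1 *)

Section step.
Variables (K t : nat).
Hypothesis tT : (t < T)%N.

Let phi (x : X) : \bar R :=
  ((clipped_weight M y c t.+1 x)%:E * likelihood_from M y K t.+1 x)%E.

Let hphi : nnmeasurable phi.
Proof.
apply: nnmeasurableM; last exact: nnmeasurable_likelihood_from.
split=> [|x]; last by rewrite lee_fin clipped_weight_ge0.
exact/measurable_EFinP/measurable_clipped_weight.
Qed.

Let G om : \bar R := ((Z_until t.+1 om)%:E * expected_likelihood K t.+1 om)%E.

(** The last factor of [Z_until] contains the sum of the weights, which cancels their
    normalization. *)
Let GE om : G om = (\sum_(n < N)
  (Z_until t om / ((propagations W t.+1 om)%:R - 1))%:E *
    phi (particle W t.+1 n om))%E.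
Proof.
rewrite /G /expected_likelihood ge0_sume_distrr; last first.
  move=> n _; apply: mule_ge0.
    by rewrite lee_fin normalized_weight_ge0// => i; exact: weight_ge0.
  exact: (nnmeasurable_likelihood_from M y K t.+1).2.
apply: eq_bigr => n _; rewrite /phi !muleA -!EFinM; congr (_%:E * _)%E.
have s0 : \sum_(m < N) weight M y c W t.+1 m om != 0.
  by rewrite gt_eqF// (sum_weight_gt0 _ _ _ _ hN hc).
have p0 : (propagations W t.+1 om)%:R - 1 != 0 :> R.
  by rewrite gt_eqF// propagationsB1_gt0.
rewrite /Z_until big_nat_recr// -/(Z_until t om).
rewrite (_ : clipped_weight _ _ _ _ _ = weight M y c W t.+1 n om)//.
move: s0 p0; move: (weight M y c W t.+1 n om) (\sum_(m < N) _).
move: ((propagations W t.+1 om)%:R - 1) => p w S s0 p0.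
by rewrite /=; field; rewrite s0 p0.
Qed.

Let mG : measurable_fun [set: Omega] G.
Proof.
apply: (measurable_fun_historyT W t.+1); apply: emeasurable_funM.
  by apply/measurable_EFinP; exact: measurable_Z_until.
exact: (nnmeasurable_expected_likelihood K t.+1 tT).1.
Qed.

Let G0 om : (0 <= G om)%E.
Proof.
apply: mule_ge0; first by rewrite lee_fin Z_until_ge0.
exact: (nnmeasurable_expected_likelihood K t.+1 tT).2.
Qed.

Let mphi (n : 'I_N.+1) (j : nat) :
  measurable_fun [set: Omega] (fun om => phi (proposal W t.+1 n j om)).
Proof.
apply: measurableT_comp hphi.1 _; apply: (measurable_fun_historyT W t.+1).
by apply: measurable_proposal; rewrite leqnn.
Qed.

Let malive : measurable (alive W t).
Proof. exact: history_measurable (measurable_alive W t t (leqnn t)). Qed.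

Let mfirst k : measurable (alive W t `&` first_at W t.+1 k).
Proof.
apply: measurableI => //.
exact: history_measurable (measurable_first_at W t.+1 k (ltn0Sn _)).
Qed.

Let acc01 om : 0 <= acceptance_at M y c W t om <= 1.
Proof.
have ct : 0 < c t.+1 by exact: hc.
have [] // := accept_integral1 M y c t.+1 (particle W t ^~ om)
  (weight M y c W t ^~ om) ct.
  by move=> n; exact: weight_ge0.
by apply: (sum_weight_gt0 _ _ _ _ hN hc); exact: ltnW.
Qed.

(** The contribution of one particle on the event of one tuple of rejection counts; it depends on
    the tuple only through the sum [m]. *)
Let level_integral m : \bar R :=
  (\int[P]_(om in alive W t)
    ((Z_until t om / (m + N)%:R * first_at_prob M y c W t m om)%:E *
      accept_integral_at M y c W t om phi))%E.

(** On this event [P_(t+1) - 1] is the constant [m + N] and the particles are proposals at fixed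
    indices, so all [N] particles contribute equally. *)
Let integral_first_at k :
  (\int[P]_(om in alive W t `&` first_at W t.+1 k) G om =
   N%:R%:E * level_integral (\sum_n k n)%N)%E.
Proof.
set m := (\sum_n k n)%N; pose F om := Z_until t om / (m + N)%:R.
have F0 om : 0 <= F om by rewrite divr_ge0// Z_until_ge0.
have mF : measurable_fun [set: historyT W t] F.
  by apply: measurable_funM => //; exact: measurable_Z_until.
rewrite (eq_integral (fun om => \sum_(n < N) (F om)%:E *
    phi (proposal W t.+1 (widen_ord (leqnSn N) n) (k (widen_ord (leqnSn N) n)) om))%E).
  rewrite ge0_integral_sum//.
  - rewrite (eq_bigr (fun=> level_integral m)).
      by rewrite sumr_const card_ord mule_natl.
    by move=> n _; rewrite (first_at_integral _ _ _ _ hN hc hW _ tT).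
  - move=> n; apply: measurable_funTS; apply: emeasurable_funM => //.
    by apply/measurable_EFinP; exact: measurable_fun_historyT mF.
  - by move=> n om _; rewrite mule_ge0 ?lee_fin//; exact: hphi.2.
move=> om; rewrite inE => -[_ fk].
have fa n := first_at_first_accepted W t.+1 k om n fk.
rewrite GE propagationsE (eq_bigr _ (fun n _ => fa n)).
by apply: eq_bigr => n _; rewrite /particle fa.
Qed.

Let level m : set Omega := alive W t `&`
  [set om | (forall n, terminates W t.+1 n om) /\
            (\sum_n first_accepted W t.+1 n om)%N = m].

Let alive_level : alive W t.+1 = \bigcup_m level m.
Proof.
rewrite aliveS; apply/seteqP; split=> [om [h1 h2]|om [m _ [h1 [h2 _]]]]//.
by eexists.
Qed.

Let trivIset_level : trivIset setT level.
Proof.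
apply/trivIsetP => i j _ _ ij; apply/seteqP; split=> // om [[_ [_ si]] [_ [_ sj]]].
by move: ij; rewrite -si -sj eqxx.
Qed.

(** Counts of sum [m] are at most [m], so ['I_m.+1] holds them and the tuples form a finite set. *)
Let levels m : {set N.+1.-tuple 'I_m.+1} :=
  [set u : N.+1.-tuple 'I_m.+1 | (\sum_(i <- u) i == m)%N]%SET.

Let levelE m : level m =
  \big[setU/set0]_(u <- enum (levels m))
    (alive W t `&` first_at W t.+1 (fun n => tnth u n)).
Proof.
rewrite -bigcup_seq; apply/seteqP; split=> om.
  move=> [h1 [h2 h3]].
  have hle n : (first_accepted W t.+1 n om < m.+1)%N.
    by rewrite ltnS -h3 (bigD1 n)//= leq_addr.
  exists [tuple Ordinal (hle n) | n < N.+1] => /=.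
    rewrite mem_enum /levels inE big_tuple; apply/eqP; rewrite -[RHS]h3.
    by apply: eq_bigr => n _; rewrite tnth_mktuple.
  split=> // n; rewrite tnth_mktuple /=.
  exact: (terminates_first_at W t.+1 om h2).
move=> [u]; rewrite /= mem_enum /levels inE big_tuple => /eqP um [h1 h2].
split=> //; split=> [n|]; first exact: first_at_terminates h2.
by rewrite -[RHS]um; apply: eq_bigr => n _; rewrite (first_at_first_accepted _ _ _ _ _ h2).
Qed.

(** There are ['C(m + N, N)] tuples of [N + 1] counts with sum [m], and their events are disjoint
    with equal integrals. *)
Let integral_level m : (\int[P]_(om in level m) G om =
  ('C(m + N, N)%:R * N%:R)%:E * level_integral m)%E.
Proof.
rewrite levelE ge0_integral_bigsetU//=.
- rewrite (eq_big_seq (fun=> N%:R%:E * level_integral m)%E); last first.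
    move=> u; rewrite mem_enum /levels inE big_tuple => /eqP um.
    by rewrite integral_first_at um.
  rewrite big_const_seq count_predT -cardE iter_addr_0 card_ord_partitions.
  by rewrite EFinM -muleA !mule_natl addnC.
- exact: enum_uniq.
- apply/trivIsetP => u v _ _ uv; apply/seteqP; split=> // om [[_ hu] [_ hv]].
  move/eqP: uv; apply; apply: eq_from_tnth => n; apply/val_inj => /=.
  by rewrite -(first_at_first_accepted _ _ _ _ n hu) (first_at_first_accepted _ _ _ _ n hv).
- exact: measurable_funTS.
Qed.

(** Summing over the levels, [bin_predn_ratio] turns the coefficients into the negative binomial law
    with [N] successes. Its mass 1 leaves the integral of [phi], which is the expected likelihood
    with one more measurement. *)
Lemma expected_likelihood_step :
  (\int[P]_(om in alive W t.+1)
     ((Z_until t.+1 om)%:E * expected_likelihood K t.+1 om) =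
   \int[P]_(om in alive W t)
     ((Z_until t om)%:E * expected_likelihood K.+1 t om))%E.
Proof.
have ct : 0 < c t.+1 by exact: hc.
have mlevel m : measurable (level m).
  rewrite levelE; apply: bigsetU_measurable => u _; exact: mfirst.
have wt n om := weight_ge0 t n om.
have swt om : 0 < \sum_(m < N) weight M y c W t m om.
  by apply: (sum_weight_gt0 _ _ _ _ hN hc); exact: ltnW.
have I0 om : (0 <= accept_integral_at M y c W t om phi)%E.
  by apply: (nnf_ge0 _ (nnf_accept_integral _ _ _ _ _ _ ct _)) => //; exact: hphi.2.
have F0 m om : 0 <= first_at_prob M y c W t m om.
  by have /andP[a0 a1] := acc01 om; rewrite mulr_ge0 ?exprn_ge0 ?subr_ge0.
have mlt m (r : R) : measurable_fun (alive W t) (fun om =>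
   ((Z_until t om / r * first_at_prob M y c W t m om)%:E *
      accept_integral_at M y c W t om phi)%E).
  apply: measurable_funTS; apply: (measurable_fun_historyT W t).
  apply: emeasurable_funM.
    apply/measurable_EFinP; apply: measurable_funM.
      by apply: measurable_funM => //; exact: measurable_Z_until.
    exact: (measurable_first_at_prob _ _ _ _ hN hc _ tT).
  exact: (measurable_accept_integral_at _ _ _ _ hN hc _ tT).
rewrite alive_level ge0_integral_bigcup//; last 2 first.
- exact: measurable_funTS.
- by move=> om _; exact: G0.
transitivity (\sum_(0 <= m <oo) \int[P]_(om in alive W t) ((Z_until t om)%:E *
   (('C(m + N.-1, N.-1)%:R * first_at_prob M y c W t m om)%:E *
     accept_integral_at M y c W t om phi)))%E.
  apply: eq_eseriesr => m _; rewrite integral_level /level_integral.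
  rewrite -ge0_integralZl_EFin//.
  - apply: eq_integral => om _; rewrite !muleA -!EFinM; congr (_%:E * _)%E.
    by rewrite -bin_predn_ratio//; ring.
  - move=> om _; rewrite mule_ge0// lee_fin mulr_ge0 ?divr_ge0 ?Z_until_ge0//.
(* Series and integral are exchanged, so that the identity remains to be checked for each
   outcome. *)
rewrite -integral_nneseries//; last 2 first.
(* [mlt] divides by [r], so the coefficient enters through its inverse. *)
- move=> m; have := mlt m ('C(m + N.-1, N.-1)%:R^-1).
  apply: eq_measurable_fun => om _; rewrite muleA -EFinM; congr (_%:E * _)%E.
  by rewrite invrK -[LHS]mulrA.
- by move=> m om _; rewrite !mule_ge0// lee_fin ?Z_until_ge0// mulr_ge0.
apply: eq_integral => om _; rewrite nneseriesZl; last first.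
  by move=> m _; rewrite mule_ge0// lee_fin mulr_ge0.
congr (_ * _)%E; rewrite /expected_likelihood.
rewrite -(accept_integral_likelihood M y c K t _ _ ct) -/(accept_integral_at _ _ _ _ _ _ _).
have /andP[a0 a1] := acc01 om.
(* At acceptance probability 0 the negative binomial law has no mass 1 to offer, but both sides
   vanish. *)
have [az|an0] := eqVneq (acceptance_at M y c W t om) 0.
  have -> : accept_integral_at M y c W t om phi = 0%E.
    exact: (accept_integral_eq0 _ _ _ _ _ _ _ ct).
  by apply: eseries0 => m _ _; rewrite mule0.
(* The parameter [N.-1] encodes [N] successes. *)
rewrite -[RHS](negative_binomial_weighted_sum (acceptance_at M y c W t om) N.-1)//.
  by apply: eq_eseriesr => m _; rewrite /first_at_prob prednK// mulrA.
by rewrite lt_neqAle eq_sym an0 a0.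
Qed.

End step.

(** * Iteration over time and the two endpoints *)

Lemma expected_likelihood_alive K t : (t + K = T)%N ->
  (\int[P]_(om in alive W T) ((Z_until T om)%:E * expected_likelihood 0 T om) =
   \int[P]_(om in alive W t) ((Z_until t om)%:E * expected_likelihood K t om))%E.
Proof.
elim: K t => [|K ih] t; first by rewrite addn0 => ->.
rewrite addnS -addSn => tK; rewrite (ih _ tK) expected_likelihood_step//.
by rewrite -tK leq_addr.
Qed.

(** At time 0 all weights are 1, so this is the average of [N] terms, each with the law [init M] of
    one initial particle. *)
Lemma expected_likelihood0 K :
  (\int[P]_om expected_likelihood K 0 om = \int[init M]_x likelihood_from M y K 0 x)%E.
Proof.
have hL := nnmeasurable_likelihood_from M y K 0.
have lawx n : (\int[P]_om likelihood_from M y K 0 (x0 W n om) =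
    \int[init M]_x likelihood_from M y K 0 x)%E.
  apply: (eq_nnfunctional (fun f : X -> \bar R => \int[P]_om f (x0 W n om))%E
    (fun f : X -> \bar R => \int[init M]_x f x)%E _ _ _ _ hL).
  - apply: nnf_integral => // f [mf _].
    exact: measurableT_comp.
  - by apply: nnf_integral => // f [mf _].
  - move=> A mA; rewrite [RHS]integral_indic// setIT.
    have mxA : measurable (x0 W n @^-1` A).
      by rewrite -[X in measurable X]setTI; exact: measurable_funP.
    rewrite (eq_integral (fun om => (\1_(x0 W n @^-1` A) om)%:E)); last first.
      by move=> om _; rewrite !indicE; congr (_ _)%:R%:E; apply/idP/idP; rewrite !inE.
    rewrite [LHS]integral_indic// setIT.
    have [h _] := hW.
    (* The marginal law of particle [n] is the joint law with [setT] in the other coordinates. *)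
    have /h : forall i : 'I_N, measurable (if i == n then A else setT) by move=> i; case: ifP.
    rewrite (bigD1 n)//= eqxx big1 ?mule1; last first.
      by move=> i /negbTE ->; rewrite probability_setT.
    move=> <-; congr (P _); apply/seteqP; split=> [om An i|om /(_ n)]; last by rewrite eqxx.
    by case: eqVneq => // ->.
rewrite /expected_likelihood ge0_integral_sum//; last 2 first.
- move=> n; apply: emeasurable_funM; first by rewrite /=; exact: measurable_cst.
  exact: measurableT_comp hL.1 _.
- move=> n om _; rewrite mule_ge0 ?lee_fin ?normalized_weight_ge0//.
  exact: hL.2.
rewrite (eq_bigr (fun n => (1 / \sum_(m < N) 1)%:E *
    \int[init M]_x likelihood_from M y K 0 x)%E); last first.
  move=> n _; rewrite -(lawx n).
  rewrite -[LHS]/(\int[P]_om ((1 / \sum_(m < N) 1)%:E *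
    likelihood_from M y K 0 (x0 W n om)))%E ge0_integralZl_EFin//.
  - by move=> om _; exact: hL.2.
  - exact: measurableT_comp hL.1 _.
  - by rewrite divr_ge0// sumr_ge0.
rewrite -ge0_sume_distrl; last by move=> n _; rewrite lee_fin divr_ge0// sumr_ge0.
rewrite sumEFin sum_normalized_weights ?mul1e//.
by rewrite sumr_const card_ord ltr0n.
Qed.

Lemma expected_likelihood_end om : expected_likelihood 0 T om = 1%E.
Proof.
rewrite /expected_likelihood /=; under eq_bigr do rewrite mule1.
by rewrite sumEFin sum_normalized_weights// (sum_weight_gt0 _ _ _ _ hN hc).
Qed.

(** At time [T] the expected likelihood is 1 and [Zhat] vanishes off [alive]; at time 0 [alive] is
    the whole space and [Z_until] is an empty product. *)
Lemma pfrc_unbiased :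
  ('E_P[Zhat M y c W T] = marginal_likelihood M y T)%E.
Proof.
transitivity (\int[P]_(om in alive W T) ((Z_until T om)%:E * expected_likelihood 0 T om))%E.
  rewrite unlock [RHS]integral_mkcond; apply: eq_integral => om _.
  rewrite /patch /Zhat expected_likelihood_end mule1.
  by case: asboolP => h; [rewrite mem_set|rewrite memNset].
rewrite (expected_likelihood_alive T 0)// alive0 /marginal_likelihood.
rewrite -expected_likelihood0; apply: eq_integral => om _.
by rewrite /Z_until big_geq// mul1e.
Qed.

End unbiasedness.

Theorem mainTheorem1 (R : realType) (dX dY dO : measure_display)
    (X : measurableType dX) (Y : measurableType dY)
    (Omega : measurableType dO) (P : probability Omega R)
    (T N : nat) (hT : (1 <= T)%N) (hN : (1 <= N)%N)
    (M : state_space_model X Y R) (y : nat -> Y) (c : nat -> R)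
    (hc : forall t, (1 <= t <= T)%N -> 0 < c t)
    (W : pf_run X P N) (hW : is_pfrc M y c W T) :
  ('E_P[Zhat M y c W T] = marginal_likelihood M y T)%E.
Proof. exact: pfrc_unbiased. Qed.
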